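(* For any weak composition $\alpha=(\alpha_1,\ldots,\alpha_n)\in\mathbb{Z}_{\ge0}^n$ with skyline diagram $D(\alpha)$, \begin{align*} r_1(D(\alpha))+r_2(D(\alpha))+r_3(D(\alpha))=&\sum_{(i_1,i_2)\in\mathrm{inv}_1(\alpha)}(\alpha_{i_2}-\alpha_{i_1})+\sum_{(i_1,i_2,i_3)\in\mathrm{inv}_2(\alpha)}(\alpha_{i_2}-\alpha_{i_3})(\alpha_{i_3}-\alpha_{i_1})\\ &+\sum_{(i_1,i_2,i_3,i_4)\in\mathrm{inv}_3(\alpha)}(\alpha_{i_2}-\alpha_{i_1})(\alpha_{i_4}-\alpha_{i_3}), \end{align*} where $\mathrm{inv}_1(\alpha)=\{(i_1,i_2): i_1<i_2,\ \alpha_{i_1}<\alpha_{i_2}\}$, $\mathrm{inv}_2(\alpha)=\{(i_1,i_2,i_3): i_1<i_2<i_3,\ \alpha_{i_1}<\alpha_{i_3}<\alpha_{i_2}\}$, $\mathrm{inv}_3(\alpha)=\{(i_1,i_2,i_3,i_4): i_1<i_2<i_3<i_4,\ \alpha_{i_1}<\alpha_{i_2},\ \alpha_{i_3}<\alpha_{i_4}\}$.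
   Context: The skyline diagram $D(\alpha)$ is the set of boxes $\{(i,j):1\le j\le\alpha_i\}$, where $(i,j)$ is the box in row $i$ (rows numbered top to bottom) and column $j$. For a diagram $D$ (a finite set of boxes): $r_1(D)$ is the number of pairs of boxes $\{(i_1,j),(i_2,j)\}$ with $i_1<i_2$, $(i_1,j)\notin D$, $(i_2,j)\in D$; $r_2(D)$ is the number of 6-box sets $\{i_1,i_2,i_3\}\times\{j_1,j_2\}$ with $i_1<i_2<i_3$, $j_1<j_2$ such that either exactly $(i_2,j_1),(i_2,j_2),(i_3,j_1)$ among them lie in $D$, or exactly $(i_2,j_1),(i_2,j_2),(i_3,j_2)$ among them lie in $D$; $r_3(D)$ is the number of 4-box sets $\{(i_1,a),(i_2,a),(i_3,b),(i_4,b)\}$ with $i_1<i_2<i_3<i_4$ (with $a<b$, $a>b$ or $a=b$) such that $(i_1,a),(i_3,b)\notin D$ and $(i_2,a),(i_4,b)\in D$. Rows range over $[n]$ and columns over positive integers. *)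

(* Defs.v *)
From mathcomp Require Import all_boot all_order all_algebra.
From mathcomp Require Import finmap all_classical.
Set Implicit Arguments.
Unset Strict Implicit.
Unset Printing Implicit Defensive.

Local Open Scope nat_scope.

(* A box (i, j) is in row i.+1 of [n] (ordinals start at 0) and in column j.
   Columns are the positive integers, so the counts below only range over
   columns j with 0 < j. *)
Notation box n := ('I_n * nat)%type.

Definition diagram (n : nat) : Type := {fset box n}.

Definition skyline n (alpha : 'I_n -> nat) : diagram n :=
  [fset ((i, j) : box n) | i in 'I_n, j in iota 1 (alpha i)]%fset.

Definition r1_sets n (D : diagram n) : set {fset box n} :=
  [set S | exists (i1 i2 : 'I_n) (j : nat),
    [/\ i1 < i2, 0 < j, S = [fset (i1, j); (i2, j)]%fset,
        (i1, j) \notin D & (i2, j) \in D]]%classic.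

Definition r2_sets n (D : diagram n) : set {fset box n} :=
  [set S | exists (i1 i2 i3 : 'I_n) (j1 j2 : nat),
    [/\ i1 < i2 < i3, 0 < j1 < j2,
        S = ([fset i1; i2; i3] `*` [fset j1; j2])%fset &
        (S `&` D = [fset (i2, j1); (i2, j2); (i3, j1)])%fset \/
        (S `&` D = [fset (i2, j1); (i2, j2); (i3, j2)])%fset]]%classic.

Definition r3_sets n (D : diagram n) : set {fset box n} :=
  [set S | exists (i1 i2 i3 i4 : 'I_n) (a b : nat),
    [/\ [&& i1 < i2, i2 < i3 & i3 < i4], 0 < a /\ 0 < b,
        S = [fset (i1, a); (i2, a); (i3, b); (i4, b)]%fset,
        (i1, a) \notin D /\ (i3, b) \notin D &
        (i2, a) \in D /\ (i4, b) \in D]]%classic.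

(* [fset_set] is fset0 on infinite sets; [finite_r1_sets], [finite_r2_sets]
   and [finite_r3_sets] below show that this never happens here. *)
Definition r1 n (D : diagram n) : nat := #|` fset_set (r1_sets D)|%fset.
Definition r2 n (D : diagram n) : nat := #|` fset_set (r2_sets D)|%fset.
Definition r3 n (D : diagram n) : nat := #|` fset_set (r3_sets D)|%fset.

Definition inv1 n (alpha : 'I_n -> nat) : {set 'I_n * 'I_n} :=
  [set p : 'I_n * 'I_n | let: (i1, i2) := p in
    (i1 < i2) && (alpha i1 < alpha i2)]%SET.

Definition inv2 n (alpha : 'I_n -> nat) : {set 'I_n * 'I_n * 'I_n} :=
  [set p : 'I_n * 'I_n * 'I_n | let: (i1, i2, i3) := p in
    (i1 < i2 < i3) && (alpha i1 < alpha i3 < alpha i2)]%SET.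

Definition inv3 n (alpha : 'I_n -> nat) : {set 'I_n * 'I_n * 'I_n * 'I_n} :=
  [set p : 'I_n * 'I_n * 'I_n * 'I_n | let: (i1, i2, i3, i4) := p in
    [&& i1 < i2, i2 < i3, i3 < i4, alpha i1 < alpha i2
      & alpha i3 < alpha i4]]%SET.

Lemma in_skyline n (alpha : 'I_n -> nat) (i : 'I_n) (j : nat) :
  ((i, j) \in skyline alpha) = (0 < j <= alpha i).
Proof.
apply/idP/idP.
  by case/imfset2P => /= x _ [y]; rewrite mem_iota add1n ltnS => ? [-> ->].
by move=> H; apply: in_imfset2; rewrite //= mem_iota add1n ltnS.
Qed.

Definition grid n (D : diagram n) : {fset box n} :=
  [fset ((i, c.2) : box n) | i in 'I_n, c in D]%fset.

Lemma in_grid n (D : diagram n) (i k : 'I_n) (j : nat) :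
  (k, j) \in D -> (i, j) \in grid D.
Proof. by move=> Dkj; apply/imfset2P; exists i => //; exists (k, j). Qed.

Lemma finite_sub_grid n (D : diagram n) (A : set {fset box n}) :
  (forall S, A S -> (S `<=` grid D)%fset) -> finite_set A.
Proof.
move=> sAG; apply: (@sub_finite_set _ _ [set` fpowerset (grid D)]%classic).
  by move=> S /sAG /=; rewrite fpowersetE.
exact: finite_fset.
Qed.

Lemma finite_r1_sets n (D : diagram n) : finite_set (r1_sets D).
Proof.
apply: (@finite_sub_grid _ D) => _ [i1 [i2 [j [_ _ -> _ Dj]]]].
by apply/fsubsetP=> x /fset2P[] ->; apply: in_grid Dj.
Qed.

Lemma finite_r2_sets n (D : diagram n) : finite_set (r2_sets D).
Proof.
apply: (@finite_sub_grid _ D) => S [i1 [i2 [i3 [j1 [j2 [_ _ defS DS]]]]]].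
have [D1 D2]: (i2, j1) \in D /\ (i2, j2) \in D.
  have sub x : x \in (S `&` D)%fset -> x \in D by case/fsetIP.
  by case: DS => DS; split; apply: sub; rewrite DS !inE eqxx ?orbT.
apply/fsubsetP=> -[i j]; rewrite defS in_fsetM /= => /andP[_ /fset2P[] ->].
  exact: in_grid D1.
exact: in_grid D2.
Qed.

Lemma finite_r3_sets n (D : diagram n) : finite_set (r3_sets D).
Proof.
apply: (@finite_sub_grid _ D).
move=> _ [i1 [i2 [i3 [i4 [a [b [_ _ -> _ [Da Db]]]]]]]].
apply/fsubsetP=> x; rewrite !inE -!orbA => /or4P[] /eqP ->;
  by [apply: in_grid Da | apply: in_grid Db].
Qed.

(* Main.v *)
(* Each box set counted by [r1], [r2] or [r3] is determined by its rows and its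
   columns. Since the rows of a skyline diagram are left-justified, for given
   rows each admissible column ranges independently over an interval
   ]alpha_i, alpha_k]; in [r2] the second pattern, with (i3, j2) but not
   (i3, j1) in the diagram, cannot occur. *)
Require Import Defs.
From mathcomp Require Import all_boot all_order all_algebra.
From mathcomp Require Import finmap all_classical zify.
Local Open Scope ring_scope.

(** Common counting principle for [r1], [r2] and [r3]: [p] will be a tuple of rows, [j] the choice
    of columns, [f p j] the resulting box set. Injectivity on dependent pairs makes the list of all
    [f p j] duplicate-free, so its length is the cardinal. *)
Lemma card_fset_set_indexed (I : finType) (J : eqType) (K : choiceType)
    (A : set K) (P : {set I}) (s : I -> seq J) (f : I -> J -> K) :
    (forall x, A x <-> exists p j, [/\ p \in P, j \in s p & x = f p j]) ->
    (forall p, p \in P -> uniq (s p)) ->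
    (forall p q j k, p \in P -> q \in P -> j \in s p -> k \in s q ->
      f p j = f q k -> (p, j) = (q, k)) ->
  #|` fset_set A|%fset = (\sum_(p in P) size (s p))%N.
Proof.
move=> AE us f_inj.
pose F (pj : {p : I & J}) := f (tag pj) (tagged pj).
set l := [seq f p j | p <- enum P, j <- s p].
have ul : uniq l.
  apply: allpairs_uniq_dep => [|p|]; first exact: enum_uniq.
    by rewrite mem_enum; apply: us.
  move=> _ _ /allpairsPdep[p [j [+ sj ->]]] /allpairsPdep[q [k [+ sk ->]]] /=.
  rewrite !mem_enum => Pp Pq /(f_inj _ _ _ _ Pp Pq sj sk).
  by case=> -> ->.
(* This presents [A] as a finite set, so [fset_set] does not take its default value. *)
have -> : A = [set` [fset x in l]%fset]%classic.
  apply/seteqP; split=> x /=; rewrite !inE.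
    case/AE=> p [j [Pp sj ->]]; apply/allpairsPdep.
    by exists p, j; rewrite mem_enum.
  case/allpairsPdep=> p [j []]; rewrite mem_enum => Pp sj ->.
  by apply/AE; exists p, j.
rewrite set_fsetK card_fseq undup_id // size_allpairs_dep sumnE big_map.
by rewrite big_enum.
Qed.

Definition cols (a b : nat) : seq nat := iota a.+1 (b - a).

Lemma mem_cols a b j : (j \in cols a b) = (a < j <= b)%N.
Proof. by rewrite mem_iota; lia. Qed.

Lemma size_cols a b : size (cols a b) = (b - a)%N.
Proof. exact: size_iota. Qed.

Lemma cols_uniq a b : uniq (cols a b).
Proof. exact: iota_uniq. Qed.

Definition colsX (a b c d : nat) : seq (nat * nat) :=
  [seq (x, y) | x <- cols a b, y <- cols c d].

Lemma mem_colsX a b c d x y :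
  ((x, y) \in colsX a b c d) = (a < x <= b)%N && (c < y <= d)%N.
Proof.
rewrite -!mem_cols; apply/allpairsP/andP => [[[x' y'] [? ? [-> ->]]] //|[Hx Hy]].
by exists (x, y).
Qed.

Lemma size_colsX a b c d : size (colsX a b c d) = ((b - a) * (d - c))%N.
Proof. by rewrite size_allpairs !size_cols. Qed.

Lemma colsX_uniq a b c d : uniq (colsX a b c d).
Proof. by apply: allpairs_uniq => [||[? ?] [? ?]]; rewrite ?cols_uniq. Qed.

Definition box_lt n (x y : box n) : bool :=
  (x.1 < y.1)%N || (x.1 == y.1) && (x.2 < y.2)%N.

(* Shows that a box set determines its rows and columns: listing the boxes in
   lexicographic order recovers them. *)
Lemma box_sorted_eq n (s t : seq (box n)) :
  sorted (@box_lt n) s -> sorted (@box_lt n) t -> s =i t -> s = t.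
Proof.
apply: irr_sorted_eq => [[y b] [x a] [z c]|[x a]]; rewrite /box_lt /=; last by lia.
rewrite -!val_eqE /=; lia.
Qed.

Lemma r1_skyline n (alpha : 'I_n -> nat) :
  r1 (skyline alpha) =
  (\sum_(p in inv1 alpha) let: (i1, i2) := p in alpha i2 - alpha i1)%N.
Proof.
pose f (p : 'I_n * 'I_n) j : {fset box n} :=
  (let: (i1, i2) := p in [fset (i1, j); (i2, j)])%fset.
pose s (p : 'I_n * 'I_n) := let: (i1, i2) := p in cols (alpha i1) (alpha i2).
rewrite /r1 (@card_fset_set_indexed _ _ _ _ (inv1 alpha) s f).
- by apply: eq_bigr => -[i1 i2] _; rewrite size_cols.
- move=> S; split=> [[i1 [i2 [j [lt_i j0 ->]]]]|[[i1 i2] [j []]]].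
    (* Since [0 < j], the box of row [i1] is missing exactly when [alpha i1 < j]. *)
    rewrite !in_skyline => Dj1 Dj2; exists (i1, i2), j.
    by split=> //; rewrite ?inE /= ?mem_cols; lia.
  rewrite !inE /= mem_cols => P1 P2 ->; exists i1, i2, j.
  by split=> //; rewrite ?in_skyline; lia.
- by move=> [i1 i2] _; apply: cols_uniq.
move=> [i1 i2] [k1 k2] j l; rewrite !inE /= => /andP[lti _] /andP[ltk _] _ _ /fsetP E.
have : [:: (i1, j); (i2, j)] = [:: (k1, l); (k2, l)].
  apply: box_sorted_eq => [||x]; rewrite /= /box_lt /= ?lti ?ltk //.
  by have := E x; rewrite !inE.
by case=> -> -> ->.
Qed.

Lemma r2_skyline n (alpha : 'I_n -> nat) :
  r2 (skyline alpha) =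
  (\sum_(p in inv2 alpha) let: (i1, i2, i3) := p in
     (alpha i2 - alpha i3) * (alpha i3 - alpha i1))%N.
Proof.
pose f (p : 'I_n * 'I_n * 'I_n) (c : nat * nat) : {fset box n} :=
  (let: (i1, i2, i3) := p in [fset i1; i2; i3] `*` [fset c.1; c.2])%fset.
pose s (p : 'I_n * 'I_n * 'I_n) := let: (i1, i2, i3) := p in
  (* Row [i3] contains the left column but not the right one, so [alpha i3] separates the two
     columns and they are automatically in increasing order. *)
  colsX (alpha i1) (alpha i3) (alpha i3) (alpha i2).
rewrite /r2 (@card_fset_set_indexed _ _ _ _ (inv2 alpha) s f).
- by apply: eq_bigr => -[[i1 i2] i3] _; rewrite size_colsX mulnC.
- move=> S; split=> [[i1 [i2 [i3 [a [b [lti ltj -> E]]]]]]|].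
    exists (i1, i2, i3), (a, b).
    have : [/\ (alpha i1 < a)%N, (a <= alpha i3)%N, (alpha i3 < b)%N
           & (b <= alpha i2)%N].
      have n12 : (i1 == i2) = false by apply/negbTE; rewrite -val_eqE /=; lia.
      have n13 : (i1 == i3) = false by apply/negbTE; rewrite -val_eqE /=; lia.
      have n32 : (i3 == i2) = false by apply/negbTE; rewrite -val_eqE /=; lia.
      have nba : (b == a) = false by apply/negbTE; lia.
      have nab : (a == b) = false by apply/negbTE; lia.
      (* Each of these four boxes yields one of the four bounds. In the second pattern they are
         contradictory: [b <= alpha i3] and [a < b] force box [(i3, a)] into the diagram. *)
      case: E => /fsetP E; move: (E (i1, a)) (E (i3, a)) (E (i3, b)) (E (i2, b));
        rewrite !inE !xpair_eqE !in_skyline !eqxx ?n12 ?n13 ?n32 ?nba ?nab ?orbT /= => *;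
        split; lia.
    move=> [? ? ? ?]; split=> //; first by rewrite inE /=; lia.
    by rewrite mem_colsX; lia.
  move=> [[[i1 i2] i3] [[a b] []]]; rewrite !inE mem_colsX => P1 P2 ->.
  exists i1, i2, i3, a, b; split=> //; [lia|lia|left].
  apply/fsetP=> -[i j]; rewrite !inE in_skyline !xpair_eqE /=.
  apply/idP/idP.
    case/andP=> /andP[/orP[/orP[]|] /eqP-> /orP[] /eqP->]; rewrite ?eqxx ?orbT //=;
    lia.
  by move=> /orP[/orP[]|] /andP[/eqP -> /eqP ->]; rewrite !eqxx ?orbT /=; lia.
- by move=> [[i1 i2] i3] _; apply: colsX_uniq.
move=> [[i1 i2] i3] [[k1 k2] k3] [a b] [c d]; rewrite !inE !mem_colsX /=.
move=> P Q Pa Qc /fsetP E.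
have : [:: (i1, a); (i1, b); (i2, a); (i2, b); (i3, a); (i3, b)] =
       [:: (k1, c); (k1, d); (k2, c); (k2, d); (k3, c); (k3, d)].
  apply: box_sorted_eq => [||[i j]]; rewrite /= /box_lt /= ?eqxx; [lia|lia|].
  (* Distributing turns membership in the product into a disjunction over its six boxes, in the
     order of the list. *)
  have := E (i, j); rewrite !inE !xpair_eqE /= !andb_orl !andb_orr -!orbA.
  by [].
by case=> *; subst.
Qed.

Lemma r3_skyline n (alpha : 'I_n -> nat) :
  r3 (skyline alpha) =
  (\sum_(p in inv3 alpha) let: (i1, i2, i3, i4) := p in
     (alpha i2 - alpha i1) * (alpha i4 - alpha i3))%N.
Proof.
pose f (p : 'I_n * 'I_n * 'I_n * 'I_n) (c : nat * nat) : {fset box n} :=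
  (let: (i1, i2, i3, i4) := p in
   [fset (i1, c.1); (i2, c.1); (i3, c.2); (i4, c.2)])%fset.
pose s (p : 'I_n * 'I_n * 'I_n * 'I_n) := let: (i1, i2, i3, i4) := p in
  colsX (alpha i1) (alpha i2) (alpha i3) (alpha i4).
rewrite /r3 (@card_fset_set_indexed _ _ _ _ (inv3 alpha) s f).
- by apply: eq_bigr => -[[[i1 i2] i3] i4] _; rewrite size_colsX.
- move=> S; split=> [[i1 [i2 [i3 [i4 [a [b [lti [a0 b0] ->]]]]]]]|].
    rewrite !in_skyline => -[D1 D3] [D2 D4]; exists (i1, i2, i3, i4), (a, b).
    by split=> //; rewrite ?inE /= ?mem_colsX; lia.
  move=> [[[[i1 i2] i3] i4] [[a b] []]]; rewrite !inE mem_colsX => P1 P2 ->.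
  exists i1, i2, i3, i4, a, b; rewrite !in_skyline.
  by do !split=> //; lia.
- by move=> [[[i1 i2] i3] i4] _; apply: colsX_uniq.
move=> [[[i1 i2] i3] i4] [[[k1 k2] k3] k4] [a b] [c d]; rewrite !inE /=.
move=> P Q _ _ /fsetP E.
(* The rows strictly increase, so the list is sorted however [a] and [b] compare; [a = b] needs no
   separate case. *)
have : [:: (i1, a); (i2, a); (i3, b); (i4, b)] =
       [:: (k1, c); (k2, c); (k3, d); (k4, d)].
  apply: box_sorted_eq => [||x]; rewrite /= /box_lt /=; [lia|lia|].
  by have := E x; rewrite !inE -!orbA.
by case=> *; subst.
Qed.

Theorem theorem4p2 (n : nat) (alpha : 'I_n -> nat) :
  (r1 (skyline alpha) + r2 (skyline alpha) + r3 (skyline alpha))%:Z =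
    \sum_(p in inv1 alpha)
      (let: (i1, i2) := p in (alpha i2)%:Z - (alpha i1)%:Z)
  + \sum_(p in inv2 alpha)
      (let: (i1, i2, i3) := p in
        ((alpha i2)%:Z - (alpha i3)%:Z) * ((alpha i3)%:Z - (alpha i1)%:Z))
  + \sum_(p in inv3 alpha)
      (let: (i1, i2, i3, i4) := p in
        ((alpha i2)%:Z - (alpha i1)%:Z) * ((alpha i4)%:Z - (alpha i3)%:Z)).
Proof.
rewrite r1_skyline r2_skyline r3_skyline !PoszD !(big_morph Posz PoszD (erefl _)).
(* In each sum, the inequalities defining the inversion set ensure that truncated subtraction agrees
   with integer subtraction. *)
congr (_ + _ + _); apply: eq_bigr.
- by move=> [i1 i2]; rewrite inE; lia.
- move=> [[i1 i2] i3]; rewrite inE => /and3P[_ lt13 lt32].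
  by rewrite PoszM -!subzn // ltnW.
move=> [[[i1 i2] i3] i4]; rewrite inE => /and5P[_ _ _ lt12 lt34].
by rewrite PoszM -!subzn // ltnW.
Qed.
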